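(* Let $\mathcal H$ be a Hilbert space and let $\{f_k\}_{k=1}^\infty$ be a sequence in $\mathcal H$ which has a representation $\{f_k\}_{k=1}^\infty=\{T^n f_1\}_{n=0}^\infty$ (that is, $f_{k+1}=Tf_k$ for all $k\in\mathbb N$) for a linear operator $T:\mathrm{span}\{f_k\}_{k=1}^\infty\to \mathrm{span}\{f_k\}_{k=1}^\infty$. Let $U:\mathcal D(U)\to\mathcal H$ be the synthesis operator of $\{f_k\}_{k=1}^\infty$, let $N_U=\{c\in\mathcal D(U): Uc=0\}$ be its kernel, and let $\mathcal T$ be the right-shift operator on scalar sequences. Then the following statements hold. (i) If $T$ is bounded, then the domain $\mathcal D(U)$ and the kernel $N_U$ are invariant under right-shifts, and $\left\{\frac{\|f_{k+1}\|}{\|f_k\|}\right\}_{k=1}^\infty\in\ell^\infty$ when $f_k\neq 0$ for all $k\in\mathbb N$. (ii) $T$ is bounded on $\mathrm{span}\{f_k\}_{k=1}^\infty$ if and only if there is a positive constant $K$ such that $$\|U\mathcal T\{c_k\}_{k=1}^\infty\|\le K\,\|U\{c_k\}_{k=1}^\infty\|\quad\text{for all finite sequences } \{c_k\}_{k=1}^\infty .$$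
   Context: $\mathrm{span}$ denotes the set of finite linear combinations (not closed). The synthesis operator of $\{f_k\}_{k=1}^\infty$ is $U:\mathcal D(U)\to\mathcal H$, $U\{c_k\}_{k=1}^\infty=\sum_{k=1}^\infty c_kf_k$, where the domain $\mathcal D(U)$ is the set of all scalar-valued sequences $\{c_k\}_{k=1}^\infty$ (not necessarily in $\ell^2$) for which $\sum_{k=1}^\infty c_kf_k$ converges in $\mathcal H$. The right-shift operator acts on an arbitrary scalar sequence by $\mathcal T\{c_k\}_{k=1}^\infty=\{0,c_1,c_2,\dots\}$. A vector space $V$ of scalar sequences is invariant under right-shifts if $\mathcal T(V)\subseteq V$. A finite sequence is a scalar sequence $\{c_k\}_{k=1}^\infty$ with only finitely many nonzero entries. *)

(* Defs.v *)
From HB Require Import structures.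
From mathcomp Require Import all_boot all_order all_algebra.
From mathcomp Require Import complex.
From mathcomp Require Import all_classical all_reals all_analysis.

Set Implicit Arguments.
Unset Strict Implicit.
Unset Printing Implicit Defensive.

Import Order.TTheory GRing.Theory Num.Theory.
Import numFieldNormedType.Exports.

Local Open Scope classical_set_scope.
Local Open Scope ring_scope.

(* "Scalar" means real or complex. *)
Inductive scalar_kind := RealScalars | ComplexScalars.

Definition scalar_field (R : realType) (s : scalar_kind) : numFieldType :=
  match s with
  | RealScalars => R : numFieldType
  | ComplexScalars => complex R : numFieldType
  end.

Definition scalar_conj (R : realType) (s : scalar_kind) :
    scalar_field R s -> scalar_field R s :=
  match s return scalar_field R s -> scalar_field R s with
  | RealScalars => idfun
  | ComplexScalars => @conjc R
  end.

(* A Hilbert space over [scalar_field R s] is a complete normed module [H]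
   together with a positive definite Hermitian form [dot] satisfying this
   predicate. Library norms take their values in the scalar field; in the
   complex case [a <= b] entails that [b - a] is a nonnegative real. *)
Definition norm_from_dot (R : realType) (s : scalar_kind)
    (H : normedModType (scalar_field R s))
    (dot : {dot H for @scalar_conj R s}) : Prop :=
  forall x : H, `|x| ^+ 2 = dot x x.

(* All sequences are indexed from 0: [f k] stands for the vector $f_{k+1}$. *)
Section Span.
Variables (K : numFieldType) (H : normedModType K) (f : nat -> H).

Definition span : {pred H} :=
  [pred x | `[< exists (n : nat) (c : nat -> K),
                  x = \sum_(0 <= k < n) c k *: f k >]].

Lemma spanP (x : H) :
  reflect (exists (n : nat) (c : nat -> K), x = \sum_(0 <= k < n) c k *: f k)
          (x \in span).
Proof. exact: asboolP. Qed.

Lemma span_submod_closed : submod_closed span.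
Proof.
split=> [|a u v /spanP[n [c ->]] /spanP[m [d ->]]]; apply/spanP.
  by exists 0%N, (fun=> 0); rewrite big_nil.
have pad (p q : nat) (e : nat -> K) : (p <= q)%N ->
    \sum_(0 <= k < p) e k *: f k =
    \sum_(0 <= k < q) (if (k < p)%N then e k else 0) *: f k.
  move=> pq; rewrite [RHS](big_cat_nat (n := p)) //= [X in _ + X]big_nat.
  rewrite [X in _ + X]big1 ?addr0; first by apply: eq_big_nat => k /andP[_ ->].
  by move=> k /andP[pk _]; rewrite ltnNge pk scale0r.
exists (maxn n m), (fun k => a * (if (k < n)%N then c k else 0)
                             + (if (k < m)%N then d k else 0)).
rewrite (pad _ _ c (leq_maxl n m)) (pad _ _ d (leq_maxr n m)).
rewrite scaler_sumr -big_split /=.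
by apply: eq_bigr => k _; rewrite scalerDl scalerA.
Qed.

HB.instance Definition _ := GRing.isSubmodClosed.Build K H span
  span_submod_closed.

Record span_type := SpanType { span_val : H; span_valP : span_val \in span }.

HB.instance Definition _ := [isSub for span_val].
HB.instance Definition _ := [Choice of span_type by <:].
HB.instance Definition _ := [SubChoice_isSubLmodule of span_type by <:].

Lemma gen_in_span (k : nat) : f k \in span.
Proof.
apply/spanP; exists k.+1, (fun i => (i == k)%:R).
rewrite big_nat_recr //= eqxx scale1r big_nat big1 ?add0r //.
by move=> i /andP[_ ik]; rewrite (ltn_eqF ik) scale0r.
Qed.

Definition span_gen (k : nat) : span_type := SpanType (gen_in_span k).

Definition bounded_operator (T : {linear span_type -> span_type}) : Prop :=
  exists2 M : K, 0 <= M & forall x : span_type, `|\val (T x)| <= M * `|\val x|.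

End Span.

Section Synthesis.
Variables (K : numFieldType) (H : normedModType K) (f : nat -> H).

Definition synthesis_domain : set (nat -> K) :=
  [set c | cvgn (series (fun k => c k *: f k))].

(* Meaningful on [synthesis_domain] only; [limn] is arbitrary elsewhere. *)
Definition synthesis (c : nat -> K) : H := limn (series (fun k => c k *: f k)).

Definition synthesis_kernel : set (nat -> K) :=
  [set c | synthesis_domain c /\ synthesis c = 0].

End Synthesis.

Section Sequences.
Variable K : numFieldType.

Definition right_shift (c : nat -> K) : nat -> K :=
  fun k => if k is j.+1 then c j else 0.

Definition shift_invariant (V : set (nat -> K)) : Prop :=
  right_shift @` V `<=` V.

Definition finite_sequence (c : nat -> K) : Prop :=
  finite_set [set k | c k != 0].

End Sequences.

(* Main.v *)
(* On partial sums the right shift is T: the (n+1)-st partial sum of the shifted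
   series is T applied to the n-th partial sum s_n of the original one. If T has
   bound M, then |T s_m - T s_n| <= M |s_m - s_n| carries the Cauchy property
   over to the shifted series, and |T s_n| <= M |s_n| carries over convergence
   to 0. Every element of the span is a partial sum of a finite sequence, so the
   inequality in (ii) is exactly the boundedness of T. *)
Require Import Defs.
From HB Require Import structures.
From mathcomp Require Import all_boot all_order all_algebra.
From mathcomp Require Import all_classical all_reals all_analysis.

Set Implicit Arguments.
Unset Strict Implicit.
Unset Printing Implicit Defensive.

Import Order.TTheory GRing.Theory Num.Theory.
Import numFieldNormedType.Exports.

Local Open Scope classical_set_scope.
Local Open Scope ring_scope.

(** The bound transfers the Cauchy property from [u] to [v]; only the target [W] has to be
    complete. *)
Lemma cvg_lipschitz_dominated (K : numFieldType) (V : normedModType K)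
    (W : completeNormedModType K) (u : nat -> V) (v : nat -> W) (M : K) :
  0 <= M -> (forall m n, `|v m - v n| <= M * `|u m - u n|) ->
  cvgn u -> cvgn v.
Proof.
move=> M0 vu /cvg_cauchy/cauchy_ballP ucauchy; apply/cauchy_cvgP/cauchy_ballP.
(* [M] may be 0, so [e] is divided by [M + 1] instead. *)
have M1 : 0 < M + 1 by rewrite ltr_wpDl.
move=> e e0; have := ucauchy _ (divr_gt0 e0 M1); rewrite !near_map2.
apply: filterS => -[m n]; rewrite -!ball_normE /= => umn.
apply: le_lt_trans (vu m n) _; apply: (@le_lt_trans _ _ ((M + 1) * `|u m - u n|)).
  by rewrite ler_wpM2r// lerDl.
by rewrite mulrC -ltr_pdivlMr.
Qed.

Lemma cvg0_dominated (K : numFieldType) (V W : normedModType K)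
    (u : nat -> V) (v : nat -> W) (M : K) :
  0 <= M -> (forall n, `|v n| <= M * `|u n|) ->
  u @ \oo --> (0 : V) -> v @ \oo --> (0 : W).
Proof.
move=> M0 vu /cvgr0Pnorm_lt u0; apply/cvgr0Pnorm_lt => e e0.
have M1 : 0 < M + 1 by rewrite ltr_wpDl.
have := u0 _ (divr_gt0 e0 M1); apply: filterS => n un.
apply: le_lt_trans (vu n) _; apply: (@le_lt_trans _ _ ((M + 1) * `|u n|)).
  by rewrite ler_wpM2r// lerDl.
by rewrite mulrC -ltr_pdivlMr.
Qed.

Lemma finite_sequence_bounded (K : numFieldType) (c : nat -> K) :
  finite_sequence c <-> exists n, forall k, (n <= k)%N -> c k = 0.
Proof.
split=> [/finite_seqP[r cr]|[n cn]].
  (* One past the largest index of the support. *)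
  exists (\max_(i <- r) i).+1 => k rk; apply/eqP; apply: contraTT rk => ck.
  have kr : k \in r by have : [set` r] k by rewrite -cr.
  by rewrite -leqNgt; exact: (@leq_bigmax_seq _ r xpredT id).
apply: (sub_finite_set _ (finite_II n)) => k /= /eqP ck.
by rewrite ltnNge; apply/negP => /cn.
Qed.

Section SpanPartialSums.
Variables (K : numFieldType) (H : normedModType K) (f : nat -> H).

(** The sum is formed in [span_type f] rather than in [H], so that [T] can be applied to it. *)
Definition span_psum (c : nat -> K) (n : nat) : span_type f :=
  \sum_(0 <= k < n) c k *: span_gen f k.

Lemma val_span_psum (c : nat -> K) (n : nat) :
  \val (span_psum c n) = series (fun k => c k *: f k) n.
Proof. by rewrite raddf_sum; apply: eq_bigr => k _; exact: GRing.valZ. Qed.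

(** Truncating the coefficients at [n] makes [x] the synthesis of a finite sequence, which is what
    the converse in (ii) needs. *)
Lemma span_psum_surj (x : span_type f) :
  exists n (c : nat -> K), (forall k, (n <= k)%N -> c k = 0) /\
    x = span_psum c n.
Proof.
have /spanP[n [c xE]] := valP x.
exists n, (fun k => if (k < n)%N then c k else 0); split.
  by move=> k nk; rewrite ltnNge nk.
apply: val_inj; rewrite val_span_psum xE.
by apply: eq_big_nat => k /andP[_ ->].
Qed.

(** The partial sums are constant from index [n] on. *)
Lemma synthesis_psum (c : nat -> K) (n : nat) :
  (forall k, (n <= k)%N -> c k = 0) -> synthesis f c = \val (span_psum c n).
Proof.
move=> cn; rewrite val_span_psum; apply: norm_lim_near_cst.
exists n => // m /= nm; rewrite /series /= (big_cat_nat (leq0n n) nm)//=.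
rewrite [X in _ + X]big_nat [X in _ + X]big1 ?addr0// => k /andP[nk _].
by rewrite cn ?scale0r.
Qed.

Variable T : {linear span_type f -> span_type f}.
Hypothesis TS : forall k, span_gen f k.+1 = T (span_gen f k).

(** The new leading term is zero, and by linearity [T] advances each remaining generator by one
    index. *)
Lemma span_psum_right_shift (c : nat -> K) (n : nat) :
  span_psum (right_shift c) n.+1 = T (span_psum c n).
Proof.
rewrite /span_psum big_nat_recl//= scale0r add0r linear_sum.
by apply: eq_bigr => k _; rewrite TS linearZ.
Qed.

Lemma synthesis_right_shift_finite (c : nat -> K) (n : nat) :
  (forall k, (n <= k)%N -> c k = 0) ->
  synthesis f (right_shift c) = \val (T (span_psum c n)).
Proof.
move=> cn; rewrite (synthesis_psum (n := n.+1)) ?span_psum_right_shift//.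
by case.
Qed.

Lemma series_right_shift (c : nat -> K) :
  [sequence series (fun k => right_shift c k *: f k) n.+1]_n =
  (fun n => \val (T (span_psum c n))).
Proof. by apply/funext => n; rewrite -span_psum_right_shift val_span_psum. Qed.

Lemma bounded_operator_synthesis :
  bounded_operator T <->
  exists2 M : K, 0 < M & forall c : nat -> K, finite_sequence c ->
    `|synthesis f (right_shift c)| <= M * `|synthesis f c|.
Proof.
split=> -[M M0 TM].
  (* An operator bound may be 0, while the constant in (ii) must be positive. *)
  exists (M + 1); first by rewrite ltr_wpDl.
  move=> c /finite_sequence_bounded[n cn].
  rewrite (synthesis_right_shift_finite cn) (synthesis_psum cn).
  by apply: le_trans (TM _) _; rewrite ler_wpM2r// lerDl.
exists M; first exact: ltW.
move=> x; have [n [c [cn ->]]] := span_psum_surj x.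
rewrite -(synthesis_right_shift_finite cn) -(synthesis_psum cn).
by apply: TM; apply/finite_sequence_bounded; exists n.
Qed.

Hypothesis Tbd : bounded_operator T.

Lemma synthesis_kernel_right_shift : shift_invariant (synthesis_kernel f).
Proof.
have [M M0 TM] := Tbd; move=> _ [c [cdom c0] <-].
have : series (fun k => right_shift c k *: f k) @ \oo --> (0 : H).
  (* Dropping the initial empty partial sum does not affect the limit. *)
  rewrite -cvg_shiftS series_right_shift.
  apply: (cvg0_dominated (u := series (fun k => c k *: f k)) (M := M)) => //.
    by move=> n; rewrite -val_span_psum.
  (* Once 0 is written as [synthesis f c], this is [cdom]. *)
  by rewrite -c0.
by move=> sc0; split; [apply/cvg_ex; exists 0 | exact: norm_cvg_lim].
Qed.

Lemma bounded_fun_norm_ratio :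
  bounded_fun (fun k : nat => `|f k.+1| / `|f k|).
Proof.
have [M M0 TM] := Tbd; exists M; split; first exact: ger0_real.
move=> N MN k _ /=; rewrite ger0_norm ?divr_ge0//; apply: le_trans (ltW MN).
(* The inverse of 0 is 0 by convention, so the ratio is 0 in this case. *)
have [->|fk0] := eqVneq (f k) 0; first by rewrite normr0 invr0 mulr0.
rewrite ler_pdivrMr ?normr_gt0//.
by have := TM (span_gen f k); rewrite -TS.
Qed.

End SpanPartialSums.

Lemma synthesis_domain_right_shift (K : numFieldType)
    (H : completeNormedModType K) (f : nat -> H)
    (T : {linear span_type f -> span_type f}) :
  (forall k, span_gen f k.+1 = T (span_gen f k)) ->
  bounded_operator T -> shift_invariant (synthesis_domain f).
Proof.
move=> TS [M M0 TM] _ [c cdom <-].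
have : cvgn (fun n => \val (T (span_psum f c n))).
  apply: (@cvg_lipschitz_dominated _ _ _ (series (fun k => c k *: f k)) _ M) => //.
  (* By linearity the difference of the images is [T] of the difference of partial sums, to which
     the operator bound applies. *)
  by move=> m n; rewrite -!val_span_psum -!raddfB; exact: TM.
rewrite -(series_right_shift TS) => /cvg_ex[l].
by rewrite cvg_shiftS => sl; apply/cvg_ex; exists l.
Qed.

Theorem theorem2p4 (R : realType) (s : scalar_kind)
    (H : completeNormedModType (scalar_field R s))
    (dot : {dot H for @scalar_conj R s}) (hdot : norm_from_dot dot)
    (f : nat -> H) (T : {linear span_type f -> span_type f})
    (hT : forall k : nat, span_gen f k.+1 = T (span_gen f k)) :
  (bounded_operator T ->
     [/\ shift_invariant (synthesis_domain f),
         shift_invariant (synthesis_kernel f) &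
         (forall k : nat, f k <> 0) ->
           bounded_fun (fun k : nat => `|f k.+1| / `|f k|)])
  /\
  (bounded_operator T <->
     exists2 M : scalar_field R s, 0 < M &
       forall c : nat -> scalar_field R s, finite_sequence c ->
         `|synthesis f (right_shift c)| <= M * `|synthesis f c|).
Proof.
split; last exact: bounded_operator_synthesis.
move=> Tbd; split.
- exact: synthesis_domain_right_shift hT Tbd.
- exact: synthesis_kernel_right_shift hT Tbd.
- by move=> _; exact: bounded_fun_norm_ratio hT Tbd.
Qed.
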